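(* Each of the following triples $(c,\gamma,\delta)$ is a solution of the left fish equation: (1) $c(i,j)=t_jz_i+z_j$, $\gamma(i,j)=1$, $\delta(i,j)=t_i$; (2) $c(i,j)=t_jz_i+z_j$, $\gamma(i,j)=z_j$, $\delta(i,j)=-z_i$; (3) $c(i,j)=t_iz_j+z_i$, $\gamma(i,j)=-(t_j+1)z_j$, $\delta(i,j)=(t_i+1)z_it_j$; (4) $c(i,j)=t_iz_j+z_i$, $\gamma(i,j)=t_j+1$, $\delta(i,j)=t_i+1$. Moreover, if $(c,\gamma_1,\delta_1)$ and $(c,\gamma_2,\delta_2)$ are solutions with the same $c$, then $(c,\lambda\gamma_1+\mu\gamma_2,\lambda\delta_1+\mu\delta_2)$ is a solution for all constants $\lambda,\mu\in\mathbb{C}$ (independent of $z_i,z_j,t_i,t_j$).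
   Context: Let $\gamma(i,j),\delta(i,j),c(i,j)$ denote expressions in complex variables $z_i,t_i,z_j,t_j$, and let $\gamma(j,i)$ denote the same expression with $(z_i,t_i)$ and $(z_j,t_j)$ interchanged (similarly for $\delta$). The triple $(c,\gamma,\delta)$ is a solution of the left fish equation if, identically in $z_i,z_j,t_i,t_j$, $$\gamma(i,j)\,c(i,j)=\gamma(j,i)\,(t_j+1)z_j+\delta(j,i)\,(z_i-z_j),$$ $$\delta(i,j)\,c(i,j)=\delta(j,i)\,(t_i+1)z_i+\gamma(j,i)\,(t_iz_j-t_jz_i).$$ *)

(* Defs.v *)
From Stdlib Require Import Reals.
From Coquelicot Require Import Coquelicot.

Open Scope C_scope.

(* An expression e(i,j) in the complex variables z_i, t_i, z_j, t_j, with the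
   arguments in this order. *)
Definition fish_expr : Type := C -> C -> C -> C -> C.

(* e(j,i): the pairs (z_i, t_i) and (z_j, t_j) are interchanged. *)
Definition interchange (e : fish_expr) : fish_expr := fun zi ti zj tj => e zj tj zi ti.

Definition left_fish_solution (c gamma delta : fish_expr) : Prop :=
  forall zi ti zj tj : C,
    gamma zi ti zj tj * c zi ti zj tj =
      interchange gamma zi ti zj tj * (tj + 1) * zj
      + interchange delta zi ti zj tj * (zi - zj)
    /\
    delta zi ti zj tj * c zi ti zj tj =
      interchange delta zi ti zj tj * (ti + 1) * zi
      + interchange gamma zi ti zj tj * (ti * zj - tj * zi).

(* Main.v *)
Require Import Defs.
From Stdlib Require Import Reals.
From Coquelicot Require Import Coquelicot.

Open Scope C_scope.

(** For each explicit triple both equations are polynomial identities over [C]. For fixed [c] both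
    equations are linear in the pair (gamma, delta): interchanging the indices respects sums and
    leaves the constants [lambda], [mu] unchanged, so the solutions form a vector space. *)

Theorem theorem6p2 :
  left_fish_solution
    (fun zi ti zj tj => tj * zi + zj)
    (fun zi ti zj tj => 1)
    (fun zi ti zj tj => ti)
  /\ left_fish_solution
    (fun zi ti zj tj => tj * zi + zj)
    (fun zi ti zj tj => zj)
    (fun zi ti zj tj => - zi)
  /\ left_fish_solution
    (fun zi ti zj tj => ti * zj + zi)
    (fun zi ti zj tj => - (tj + 1) * zj)
    (fun zi ti zj tj => (ti + 1) * zi * tj)
  /\ left_fish_solution
    (fun zi ti zj tj => ti * zj + zi)
    (fun zi ti zj tj => tj + 1)
    (fun zi ti zj tj => ti + 1)
  /\ (forall c gamma1 delta1 gamma2 delta2 : fish_expr,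
        left_fish_solution c gamma1 delta1 ->
        left_fish_solution c gamma2 delta2 ->
        forall lambda mu : C,
          left_fish_solution c
            (fun zi ti zj tj => lambda * gamma1 zi ti zj tj + mu * gamma2 zi ti zj tj)
            (fun zi ti zj tj => lambda * delta1 zi ti zj tj + mu * delta2 zi ti zj tj)).
Proof.
  do 4 (split; [intros zi ti zj tj; unfold interchange; split; ring |]).
  intros c gamma1 delta1 gamma2 delta2 sol1 sol2 lambda mu zi ti zj tj.
  destruct (sol1 zi ti zj tj) as [Hgamma1 Hdelta1].
  destruct (sol2 zi ti zj tj) as [Hgamma2 Hdelta2].
  unfold interchange in *; split.
  (* Distributing and reassociating exposes each product with [c] in the form of a hypothesis;
     substitution eliminates [c], leaving a linear identity in the interchanged values. *)
  - rewrite Cmult_plus_distr_r, <- !Cmult_assoc, Hgamma1, Hgamma2; ring.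
  - rewrite Cmult_plus_distr_r, <- !Cmult_assoc, Hdelta1, Hdelta2; ring.
Qed.
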